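(* Let $(X,\rho)$ be a complete CAT$(-1)$ space and let $K\subset X$ be a nonempty closed convex subset. Then $K$ has the fixed point property for nonexpansive mappings (that is, every nonexpansive mapping $T\colon K\to K$ has a fixed point) if and only if $K$ is geodesically bounded.
   Context: A geodesic metric space $X$ is a CAT$(-1)$ space if every geodesic triangle $\triangle(x,y,z)$ in $X$ (three points together with metric segments joining them pairwise) satisfies the following: if $\bar\triangle$ is a comparison triangle in the hyperbolic plane $\mathbb{H}^2$ of constant curvature $-1$ (a triangle with the same side lengths), then $\rho(a,b)\le d(\bar a,\bar b)$ for all $a,b\in\triangle$, where $\bar a,\bar b\in\bar\triangle$ are the comparison points of $a,b$ and $d$ is the hyperbolic distance. In such a space any two points $x,y$ are joined by a unique metric segment $[x,y]$. A subset $K\subset X$ is convex if $[x,y]\subset K$ whenever $x,y\in K$. It is geodesically bounded if it contains no infinite geodesic, i.e. there is no isometric embedding $c\colon[0,\infty)\to X$ with image contained in $K$. A mapping $T\colon K\to K$ is nonexpansive if $\rho(Tx,Ty)\le\rho(x,y)$ for all $x,y\in K$. *)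

(* Defs.v *)
From HB Require Import structures.
From mathcomp Require Import all_boot all_order all_algebra.
From mathcomp Require Import all_classical all_reals all_analysis.

Set Implicit Arguments.
Unset Strict Implicit.
Unset Printing Implicit Defensive.

Import Order.TTheory GRing.Theory Num.Theory.

Local Open Scope classical_set_scope.
Local Open Scope ring_scope.

#[short(type="completeMetricType")]
HB.structure Definition CompleteMetric (R : numDomainType) :=
  {M of Complete M & Metric R M}.

(* These notions take the distance as a parameter: they are used both for
   [mdist] on a metric space and for [hdist] on the hyperbolic plane. *)
Section geodesics.
Context {R : realType} {T : Type} (d : T -> T -> R).

Definition isometric_on (I : set R) (c : R -> T) : Prop :=
  forall s t, I s -> I t -> d (c s) (c t) = `|s - t|.

Definition metric_segment (x y : T) (S : set T) : Prop :=
  exists c : R -> T,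
    [/\ isometric_on `[0, d x y] c, c 0 = x, c (d x y) = y
      & S = c @` `[0, d x y]].

Definition geodesic_space : Prop :=
  forall x y, exists S, metric_segment x y S.

(* The side [S i] joins the vertex [p i] to the next vertex, cyclically. *)
Definition geodesic_triangle (p : 'I_3 -> T) (S : 'I_3 -> set T) : Prop :=
  forall i, metric_segment (p i) (p (ordS i)) (S i).

Definition geodesically_convex (K : set T) : Prop :=
  forall x y S, K x -> K y -> metric_segment x y S -> S `<=` K.

Definition geodesically_bounded (K : set T) : Prop :=
  ~ exists c : R -> T,
      isometric_on `[0, +oo[ c /\ c @` `[0, +oo[ `<=` K.

Definition nonexpansive_on (K : set T) (f : T -> T) : Prop :=
  forall x y, K x -> K y -> d (f x) (f y) <= d x y.

Definition nonexpansive_fixed_point_property (K : set T) : Prop :=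
  forall f : {fun K >-> K}, nonexpansive_on K f -> exists2 x, K x & f x = x.

End geodesics.

Section hyperbolic_plane.
Context {R : realType}.

(* Hyperboloid model: the upper sheet of x0^2 - x1^2 - x2^2 = 1, with
   cosh (hdist x y) = x0 y0 - x1 y1 - x2 y2. *)
Record hyperbolic_plane := HyperbolicPlane {
  hx0 : R;
  hx1 : R;
  hx2 : R;
  hx0_gt0 : 0 < hx0;
  hyperboloidP : hx0 ^+ 2 - hx1 ^+ 2 - hx2 ^+ 2 == 1
}.

Definition arcosh (t : R) : R := ln (t + Num.sqrt (t ^+ 2 - 1)).

Definition hdist (x y : hyperbolic_plane) : R :=
  arcosh (hx0 x * hx0 y - hx1 x * hx1 y - hx2 x * hx2 y).

End hyperbolic_plane.
Arguments hyperbolic_plane : clear implicits.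

Section CAT.
Context {R : realType} {T : Type} (d : T -> T -> R).

Definition comparison_triangle (p : 'I_3 -> T)
    (p' : 'I_3 -> hyperbolic_plane R) (S' : 'I_3 -> set (hyperbolic_plane R)) :
    Prop :=
  geodesic_triangle hdist p' S' /\
  forall i, hdist (p' i) (p' (ordS i)) = d (p i) (p (ordS i)).

(* [a'] is the comparison point of [a], regarded as a point of the [i]-th
   side (a point lying on several sides has one for each of them). *)
Definition comparison_point (p : 'I_3 -> T) (S : 'I_3 -> set T)
    (p' : 'I_3 -> hyperbolic_plane R) (S' : 'I_3 -> set (hyperbolic_plane R))
    (i : 'I_3) (a : T) (a' : hyperbolic_plane R) : Prop :=
  [/\ S i a, S' i a' & hdist (p' i) a' = d (p i) a].

Definition CAT_minus1 : Prop :=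
  geodesic_space d /\
  forall p S p' S',
    geodesic_triangle d p S -> comparison_triangle p p' S' ->
    forall i j a b a' b',
      comparison_point p S p' S' i a a' ->
      comparison_point p S p' S' j b b' ->
      d a b <= hdist a' b'.

End CAT.

(* Main.v *)
Require Import Defs.
From mathcomp Require Import all_boot all_order all_algebra.
From mathcomp Require Import all_classical all_reals all_analysis.
From mathcomp Require Import ring lra.

(** The geometry of [X] enters only through one inequality, a Stewart-type
    consequence of the CAT(-1) condition ([CAT_cosh_le]): for a point [m] at
    distance [s] from [y] on a segment of length [l] from [y] to [z],
      sinh l * cosh d(x,m) <= sinh(l-s) * cosh d(x,y) + sinh s * cosh d(x,z).
    In the hyperboloid model this is an equality, because the geodesic from [y]
    to [z] is the combination of the vectors [y] and [z] with weights
    sinh(l-s)/sinh l and sinh s/sinh l, and cosh of the distance is bilinear.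

    A ray obstructs the fixed point property in any metric space: the Busemann
    function of a ray [c] is 1-Lipschitz and equals [-t] at [c t], so pushing
    every point to the ray by means of it and then moving one unit forward is
    nonexpansive and fixes nothing ([ray_translation]).

    Conversely, let [f] be a nonexpansive self-map of [K] and [o] a point of
    [K].
    If the orbit of [o] is bounded, it has an asymptotic center: by the
    inequality at midpoints, points nearly minimizing the limsup of the cosh of
    the distance to the orbit are close to each other. Since [f] does not
    increase this limsup, a minimizing sequence converges to a fixed point
    ([bounded_orbit_fixed]).
    If the orbit is unbounded, consider the first time [n k] at which it is
    farther than [k+1] from [o], and the point [y k] reached then. For [k <= j],
    nonexpansiveness bounds d(y k, y j) by the distance from [o] to the point
    of the orbit of index [n j - n k], which is at most d(o, y j): the Gromov
    products of the [y k] tend to infinity. Two uses of the inequality show that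
    the segments from [o] to the [y k] then converge pointwise, with an explicit
    rate ([thin_segments]); the limit is a ray in [K], since [K] is closed and
    convex ([unbounded_orbit_ray]). So if [K] contains no ray every orbit is
    bounded, and [f] has a fixed point. *)

Set Implicit Arguments.
Unset Strict Implicit.
Unset Printing Implicit Defensive.

Import Order.TTheory GRing.Theory Num.Theory.

Local Open Scope classical_set_scope.
Local Open Scope ring_scope.

(** * Hyperbolic functions *)

Section hyperbolic_functions.
Context {R : realType}.
Implicit Types x y t : R.

Definition cosh x : R := (expR x + expR (- x)) / 2.
Definition sinh x : R := (expR x - expR (- x)) / 2.

Lemma cosh0 : cosh 0 = 1.
Proof. by rewrite /cosh oppr0 expR0; field. Qed.

Lemma sinh0 : sinh 0 = 0.
Proof. by rewrite /sinh oppr0 expR0; field. Qed.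

Lemma coshN x : cosh (- x) = cosh x.
Proof. by rewrite /cosh opprK addrC. Qed.

Lemma sinhN x : sinh (- x) = - sinh x.
Proof. by rewrite /sinh opprK; field. Qed.

Lemma cosh_norm x : cosh `|x| = cosh x.
Proof. by case: (ger0P x) => // _; rewrite coshN. Qed.

Lemma coshB x y : cosh (x - y) = cosh x * cosh y - sinh x * sinh y.
Proof. by rewrite /cosh /sinh opprD opprK !expRD; field. Qed.

Lemma coshD x y : cosh (x + y) = cosh x * cosh y + sinh x * sinh y.
Proof. by rewrite /cosh /sinh opprD !expRD; field. Qed.

Lemma sinhB x y : sinh (x - y) = sinh x * cosh y - cosh x * sinh y.
Proof. by rewrite /cosh /sinh opprD opprK !expRD; field. Qed.

Lemma cosh2_sinh2 x : cosh x ^+ 2 = 1 + sinh x ^+ 2.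
Proof.
by rewrite -(expRxMexpNx_1 x) /cosh /sinh; field.
Qed.

Lemma cosh_gt0 x : 0 < cosh x.
Proof. by rewrite /cosh; have := expR_gt0 x; have := expR_gt0 (- x); lra. Qed.

Lemma sinh_ge0 x : 0 <= x -> 0 <= sinh x.
Proof.
move=> x0; have : expR (- x) <= expR x by rewrite ler_expR; lra.
by rewrite /sinh; lra.
Qed.

Lemma sinh_gt0 x : 0 < x -> 0 < sinh x.
Proof.
move=> x0; have : expR (- x) < expR x by rewrite ltr_expR; lra.
by rewrite /sinh; lra.
Qed.

Lemma cosh_ge1 x : 1 <= cosh x.
Proof.
have := cosh2_sinh2 x; have := cosh_gt0 x; have := sqr_ge0 (sinh x); nra.
Qed.

Lemma le_cosh x y : 0 <= x -> x <= y -> cosh x <= cosh y.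
Proof.
move=> x0 xy; have -> : y = x + (y - x) by ring.
have y0 : 0 <= y - x by lra.
rewrite coshD; have := cosh_ge1 (y - x).
have := mulr_ge0 (sinh_ge0 x0) (sinh_ge0 y0).
have := cosh_gt0 x; nra.
Qed.

Lemma expR_cosh_sinh x : expR x = cosh x + sinh x.
Proof. by rewrite /cosh /sinh; field. Qed.

Lemma cosh_le_sinhD1 x : 0 <= x -> cosh x <= 1 + sinh x.
Proof.
move=> x0; have : expR (- x) <= 1 by rewrite expR_le1; lra.
by rewrite /cosh /sinh; lra.
Qed.

Lemma arcosh_cosh x : 0 <= x -> arcosh (cosh x) = x.
Proof.
move=> x0; rewrite /arcosh cosh2_sinh2.
have -> : 1 + sinh x ^+ 2 - 1 = sinh x ^+ 2 by ring.
by rewrite sqrtr_sqr ger0_norm ?sinh_ge0// -expR_cosh_sinh expRK.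
Qed.

Lemma arcosh_ge0 t : 1 <= t -> 0 <= arcosh t.
Proof.
by move=> t1; apply: ln_ge0; have := sqrtr_ge0 (t ^+ 2 - 1); lra.
Qed.

Lemma cosh_arcosh t : 1 <= t -> cosh (arcosh t) = t.
Proof.
move=> t1; rewrite /cosh expRN /arcosh.
set q := Num.sqrt _.
have q0 : 0 <= q by exact: sqrtr_ge0.
have q2 : q ^+ 2 = t ^+ 2 - 1 by rewrite sqr_sqrtr//; nra.
have tq : 0 < t + q by lra.
rewrite lnK ?posrE//.
have -> : (t + q)^-1 = t - q.
  apply: (mulfI (lt0r_neq0 tq)); rewrite divff ?lt0r_neq0//; nra.
by field.
Qed.

Lemma sinh_ge_half x : 0 <= x -> x / 2 <= sinh x.
Proof.
move=> x0; have : expR (- x) <= 1 by rewrite expR_le1; lra.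
by rewrite /sinh; have := expR_ge1Dx x; lra.
Qed.

Lemma cosh_ge_sqr x : 1 + x ^+ 2 / 8 <= cosh x.
Proof.
rewrite -(cosh_norm x) -(real_normK (num_real x)).
have : 0 <= `|x| by [].
move: `|x| => {}x x0.
have -> : cosh x = 1 + 2 * sinh (x / 2) ^+ 2.
  have {1}-> : x = x / 2 + x / 2 by field.
  by rewrite coshD -!expr2 cosh2_sinh2; ring.
have : x / 2 / 2 <= sinh (x / 2) by apply: sinh_ge_half; lra.
nra.
Qed.

End hyperbolic_functions.

(** * The hyperbolic plane *)

Section hyperbolic_geodesics.
Context {R : realType}.
Implicit Types x y z : hyperbolic_plane R.

(** The Lorentz form with signature (+,-,-). *)
Definition hform x y : R := hx0 x * hx0 y - hx1 x * hx1 y - hx2 x * hx2 y.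

Lemma hformC x y : hform x y = hform y x.
Proof. by rewrite /hform; ring. Qed.

Lemma hformxx x : hform x x = 1.
Proof. by have /eqP := hyperboloidP x; rewrite /hform -!expr2. Qed.

Lemma hyperbolic_plane_eq x y :
  hx0 x = hx0 y -> hx1 x = hx1 y -> hx2 x = hx2 y -> x = y.
Proof.
case: x y => [x0 x1 x2 px hx] [y0 y1 y2 py hy] /= e0 e1 e2; subst.
by congr HyperbolicPlane; exact: bool_irrelevance.
Qed.

Lemma hx0_sqr x : hx0 x ^+ 2 = 1 + hx1 x ^+ 2 + hx2 x ^+ 2.
Proof. by have /eqP := hyperboloidP x; lra. Qed.

(** Lagrange's identity, which yields both the reversed Cauchy-Schwarz
    inequality [hform_ge1] and its equality case [hform_eq1]. *)
Lemma sqr_hform x y :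
  (hx0 x * hx0 y) ^+ 2 = (1 + hx1 x * hx1 y + hx2 x * hx2 y) ^+ 2 +
    ((hx1 x - hx1 y) ^+ 2 + (hx2 x - hx2 y) ^+ 2 +
     (hx1 x * hx2 y - hx2 x * hx1 y) ^+ 2).
Proof.
by rewrite exprMn !hx0_sqr; ring.
Qed.

Lemma hform_ge1 x y : 1 <= hform x y.
Proof.
have := sqr_hform x y; rewrite /hform.
have := mulr_gt0 (hx0_gt0 x) (hx0_gt0 y).
have := sqr_ge0 (hx1 x - hx1 y); have := sqr_ge0 (hx2 x - hx2 y).
have := sqr_ge0 (hx1 x * hx2 y - hx2 x * hx1 y).
move: (hx0 x * hx0 y) (hx1 x * hx1 y) (hx2 x * hx2 y) => p q r.
nra.
Qed.

Lemma hform_eq1 x y : hform x y = 1 -> x = y.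
Proof.
move=> e; have := sqr_hform x y.
have -> : hx0 x * hx0 y = 1 + hx1 x * hx1 y + hx2 x * hx2 y.
  by move: e; rewrite /hform; lra.
have h1 := sqr_ge0 (hx1 x - hx1 y); have h2 := sqr_ge0 (hx2 x - hx2 y).
have h3 := sqr_ge0 (hx1 x * hx2 y - hx2 x * hx1 y) => h.
have /eqP : (hx1 x - hx1 y) ^+ 2 = 0 by lra.
rewrite sqrf_eq0 subr_eq0 => /eqP e1.
have /eqP : (hx2 x - hx2 y) ^+ 2 = 0 by lra.
rewrite sqrf_eq0 subr_eq0 => /eqP e2.
apply: hyperbolic_plane_eq => //.
apply/eqP; rewrite -(@eqrXn2 _ 2)// ?ltW ?hx0_gt0//.
by rewrite !hx0_sqr e1 e2.
Qed.

Lemma cosh_hdist x y : cosh (hdist x y) = hform x y.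
Proof. by rewrite cosh_arcosh// hform_ge1. Qed.

Lemma hdist_sym x y : hdist x y = hdist y x.
Proof. by congr arcosh; exact: hformC. Qed.

Lemma hdist_ge0 x y : 0 <= hdist x y.
Proof. by rewrite arcosh_ge0// hform_ge1. Qed.

Lemma hform_hdist x y d : 0 <= d -> hform x y = cosh d -> hdist x y = d.
Proof. by move=> d0 e; rewrite /hdist -/(hform x y) e arcosh_cosh. Qed.

Definition hpoint (a b c : R) (a0 : 0 < a) (e : a ^+ 2 - b ^+ 2 - c ^+ 2 = 1) :=
  HyperbolicPlane a0 (introT eqP e).

(** This is the form between the points of parameters [s] and [t] of a geodesic
    of length [l], up to the factor sinh l ^ 2. *)
Lemma sinh_weights l s t :
  sinh (l - s) * sinh (l - t) + sinh s * sinh t +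
    (sinh (l - s) * sinh t + sinh s * sinh (l - t)) * cosh l =
  sinh l ^+ 2 * cosh (s - t) :> R.
Proof.
rewrite !sinhB coshB.
have e : cosh l ^+ 2 = 1 + sinh l ^+ 2 by exact: cosh2_sinh2.
ring: e.
Qed.

(** The geodesic is the curve of vectors
    (sinh (l - s) y + sinh s z) / sinh l with l = d(y,z); the last clause records
    that cosh of the distance to it is linear in these weights. *)
Lemma hyperbolic_geodesic y z : exists c : R -> hyperbolic_plane R,
  [/\ isometric_on hdist `[0, hdist y z] c, c 0 = y, c (hdist y z) = z &
    forall x s, 0 <= s <= hdist y z ->
      sinh (hdist y z) * hform x (c s) =
      sinh (hdist y z - s) * hform x y + sinh s * hform x z].
Proof.
have := hdist_ge0 y z; rewrite le_eqVlt => /predU1P[l0|l0].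
  have yz : y = z by apply: hform_eq1; rewrite -cosh_hdist -l0 cosh0.
  exists (fun=> y); rewrite -l0; split=> //.
  - move=> s t /=; rewrite !in_itv/= => /andP[? ?] /andP[? ?].
    have -> : s = 0 by lra.
    have -> : t = 0 by lra.
    by rewrite subrr normr0 {2}yz.
  - move=> x s /andP[? ?]; have -> : s = 0 by lra.
    by rewrite subr0 sinh0; ring.
set l := hdist y z in l0 *.
have sl := sinh_gt0 l0.
have cl : hform y z = cosh l by rewrite cosh_hdist.
pose a s := sinh (l - s) / sinh l; pose b s := sinh s / sinh l.
have form s : exists p, 0 <= s <= l -> [/\ hx0 p = a s * hx0 y + b s * hx0 z,
    hx1 p = a s * hx1 y + b s * hx1 z & hx2 p = a s * hx2 y + b s * hx2 z].
  case: (boolP (0 <= s <= l)) => [/andP[s0 sl']|_]; last by exists y.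
  have a0 : 0 <= a s by apply: divr_ge0; [apply: sinh_ge0; lra|exact: ltW].
  have b0 : 0 <= b s by apply: divr_ge0; [exact: sinh_ge0|exact: ltW].
  have nrm : a s ^+ 2 + b s ^+ 2 + 2 * (a s * b s) * cosh l = 1.
    have := sinh_weights l s s; rewrite subrr cosh0 /a /b => e.
    have n0 : sinh l != 0 by rewrite gt_eqF.
    by apply: (mulfI (expf_neq0 2 n0)); rewrite -[RHS]e; field.
  have p0 : 0 < a s * hx0 y + b s * hx0 z.
    have y0 := hx0_gt0 y; have z0 := hx0_gt0 z.
    move: a0; rewrite le_eqVlt => /predU1P[a0|a0].
      rewrite -a0 mul0r add0r mulr_gt0// lt_neqAle b0 andbT.
      by apply/eqP => b00; move: nrm; rewrite -a0 -b00; lra.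
    by apply: ltr_wpDr; [exact: mulr_ge0 (ltW z0)|exact: mulr_gt0].
  have pe : (a s * hx0 y + b s * hx0 z) ^+ 2 - (a s * hx1 y + b s * hx1 z) ^+ 2
     - (a s * hx2 y + b s * hx2 z) ^+ 2 = 1.
    rewrite -[RHS]nrm -cl.
    rewrite /hform; ring: (hx0_sqr y) (hx0_sqr z).
  by exists (hpoint p0 pe).
have [c cE] := choice form.
have lin x s : 0 <= s <= l ->
    hform x (c s) = a s * hform x y + b s * hform x z.
  by move=> /cE[e0 e1 e2]; rewrite /hform e0 e1 e2; ring.
exists c; split.
- move=> s t /=; rewrite !in_itv/= => sl' tl.
  apply: hform_hdist => //; rewrite cosh_norm lin//.
  rewrite hformC (hformC _ z) !lin// !hformxx (hformC z) cl.
  have := sinh_weights l s t; rewrite /a /b => e.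
  have n0 : sinh l != 0 by rewrite gt_eqF.
  by apply: (mulfI (expf_neq0 2 n0)); rewrite -[RHS]e; field.
- have [|] := cE 0; first by rewrite lexx ltW.
  rewrite /a /b subr0 sinh0 mul0r divff ?gt_eqF// !mul1r !mul0r !addr0.
  exact: hyperbolic_plane_eq.
- have [|] := cE l; first by rewrite lexx ltW.
  rewrite /a /b subrr sinh0 mul0r divff ?gt_eqF// !mul1r !mul0r !add0r.
  exact: hyperbolic_plane_eq.
- move=> x s /lin ->; rewrite /a /b; field.
  by rewrite gt_eqF.
Qed.

(** Comparison triangles exist: with [y] the apex of the hyperboloid and [z]
    above an axis, the first coordinate of [x] is forced by the law of cosines,
    and the triangle inequalities say precisely that a second one exists. *)
Lemma hyperbolic_triangle (a b c : R) : 0 < a -> 0 <= c ->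
  a <= b + c -> b <= a + c -> c <= a + b ->
  exists y z x, [/\ hdist y z = a, hdist z x = b & hdist x y = c].
Proof.
move=> a0 c0 abc bac cab.
have b0 : 0 <= b by lra.
have sa := sinh_gt0 a0; have sc := sinh_ge0 c0.
have ca := cosh2_sinh2 a; have cc := cosh2_sinh2 c.
pose u := (cosh a * cosh c - cosh b) / sinh a.
have uE : sinh a * u = cosh a * cosh c - cosh b.
  by rewrite /u; field; rewrite gt_eqF.
have u2 : u ^+ 2 <= sinh c ^+ 2.
  have h1 : cosh (a - c) <= cosh b.
    by rewrite -(cosh_norm (a - c)) le_cosh// ler_norml; apply/andP; split; lra.
  have h2 : cosh b <= cosh (a + c) by rewrite le_cosh.
  have h : `|sinh a * u| <= sinh a * sinh c.
    move: h1 h2; rewrite uE coshB coshD => h1 h2.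
    by rewrite ler_norml; apply/andP; split; lra.
  move: h; rewrite normrM gtr0_norm// ler_pM2l// => h.
  by rewrite -(real_normK (num_real u)) lerXn2r// nnegrE.
pose v := Num.sqrt (sinh c ^+ 2 - u ^+ 2).
have v2 : v ^+ 2 = sinh c ^+ 2 - u ^+ 2 by rewrite sqr_sqrtr// subr_ge0.
have ey : 1 ^+ 2 - 0 ^+ 2 - 0 ^+ 2 = 1 :> R by ring.
have ez : cosh a ^+ 2 - sinh a ^+ 2 - 0 ^+ 2 = 1 by rewrite ca; ring.
have ex : cosh c ^+ 2 - u ^+ 2 - v ^+ 2 = 1 by rewrite v2 cc; ring.
exists (hpoint ltr01 ey), (hpoint (cosh_gt0 a) ez), (hpoint (cosh_gt0 c) ex).
split; apply: hform_hdist; rewrite // ?ltW// /hform /=; [ring| |ring].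
by rewrite uE; ring.
Qed.

End hyperbolic_geodesics.

(** * The comparison inequality *)

Definition triple (A : Type) (a b c : A) (i : 'I_3) : A :=
  match val i with 0%N => a | 1%N => b | _ => c end.

Section comparison.
Context {R : realType} {X : metricType R}.
Notation d := (@mdist R X).
Implicit Types x y z : X.

(** Compare the vertex [x] with a point of the opposite side, and use the
    linearity of cosh of the distance along the comparison side. The given
    segment is side 0 of the triangle, so that [x] is vertex 2. *)
Lemma CAT_cosh_le (c : R -> X) x y z (s : R) : CAT_minus1 d ->
  isometric_on d `[0, d y z] c -> c 0 = y -> c (d y z) = z ->
  0 <= s <= d y z ->
  sinh (d y z) * cosh (d x (c s)) <=
  sinh (d y z - s) * cosh (d x y) + sinh s * cosh (d x z).
Proof.
move=> [geo cat] ciso c0 cl sl.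
have : 0 <= d y z by exact: mdist_ge0.
rewrite le_eqVlt => /predU1P[l0|l0].
  move: sl; rewrite -l0 => /andP[? ?]; have -> : s = 0 by lra.
  by rewrite subr0 sinh0; lra.
have [S1 S1E] := geo z x; have [S2 S2E] := geo x y.
have [y' [z' [x' [yz' zx' xy']]]] :
    exists y' z' x' : hyperbolic_plane R, [/\ hdist y' z' = d y z, hdist z' x' = d z x
      & hdist x' y' = d x y].
  apply: hyperbolic_triangle => //; first exact: mdist_ge0.
  - by rewrite (metric_sym z) (metric_sym x y) addrC metric_triangle.
  - by rewrite (metric_sym z) addrC metric_triangle.
  - by rewrite (metric_sym x) metric_triangle.
have [c1 [c1iso c10 c1l _]] := hyperbolic_geodesic z' x'.
have [c2 [c2iso c20 c2l _]] := hyperbolic_geodesic x' y'.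
have [c3 [c3iso c30 c3l c3E]] := hyperbolic_geodesic y' z'.
have le_d : d x (c s) <= hdist x' (c3 s).
  apply: (cat (triple y z x) (triple (c @` `[0, d y z]) S1 S2)
    (triple y' z' x') (triple (c3 @` `[0, hdist y' z'])
      (c1 @` `[0, hdist z' x']) (c2 @` `[0, hdist x' y'])) _ _
    (@Ordinal 3 2 isT) (@Ordinal 3 0 isT)).
  - move=> [[|[|[|//]]] i3]; rewrite /triple /=.
    + by exists c.
    + exact: S1E.
    + exact: S2E.
  - split; move=> [[|[|[|//]]] i3]; rewrite /triple /= => //.
    + by exists c3.
    + by exists c1.
    + by exists c2.
  - split; rewrite /triple/=.
    + case: S2E => e [_ e0 _ ->]; exists 0 => //=.
      by rewrite in_itv /= lexx mdist_ge0.
    + by exists 0 => //=; rewrite in_itv /= lexx hdist_ge0.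
    + by rewrite mdistxx; apply: hform_hdist; rewrite // hformxx cosh0.
  - split; rewrite /triple/=.
    + by exists s.
    + by exists s => //=; rewrite in_itv/= yz'.
    + have z0 : `[0, d y z]%classic 0 by rewrite /= in_itv/= lexx ltW.
      rewrite -[in LHS]c30 -[in RHS]c0 ciso// c3iso// yz' //.
rewrite -yz'; apply: (@le_trans _ _ (sinh (hdist y' z') * hform x' (c3 s))).
  by rewrite ler_pM2l ?yz' ?sinh_gt0// -cosh_hdist le_cosh// mdist_ge0.
by rewrite c3E ?yz'// -!cosh_hdist xy' (metric_sym x z) -zx' (hdist_sym z').
Qed.

End comparison.

(** * Sequences in metric spaces *)

(** The lower bound [cosh_ge_sqr] turns estimates on cosh of a distance into
    estimates on its square, which is why the Cauchy condition has this form. *)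
Lemma complete_sqr_cvg (R : realType) (X : completeMetricType R)
    (u : nat -> X) (C : R) (N : nat) :
  (forall k j, (N <= k <= j)%N -> mdist (u k) (u j) ^+ 2 <= C / k.+1%:R) ->
  exists l : X, u n @[n --> \oo] --> l.
Proof.
move=> uC; suff : cvg (u @ \oo) by move=> ?; exists (lim (u @ \oo)).
apply: cauchy_cvg; apply: cauchy_exP => e e0.
pose m := Num.bound (`|C| / e ^+ 2).
have e2 : 0 < e ^+ 2 by rewrite exprn_gt0.
have hm : `|C| / e ^+ 2 < m%:R by apply: archi_boundP; rewrite divr_ge0// ltW.
pose k := maxn N m; exists (u k).
exists k => // j /= kj; rewrite ballEmdist /=.
rewrite -(@ltr_pXn2r _ 2)// ?nnegrE ?mdist_ge0// ?ltW//.
apply: le_lt_trans (uC k j _) _; first by rewrite leq_maxl.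
have k0 : 0 < k.+1%:R :> R by rewrite ltr0n.
rewrite ltr_pdivrMr// mulrC -ltr_pdivrMr//.
apply: le_lt_trans (_ : _ <= `|C| / e ^+ 2) _.
  by rewrite ler_pM2r ?invr_gt0// ler_norm.
by apply: lt_le_trans hm _; rewrite ler_nat ltnW// ltnS leq_maxr.
Qed.

Section limits_of_distances.
Context {R : realType} {X : metricType R}.
Notation d := (@mdist R X).

Lemma le_mdistD (x y x' y' : X) : d x y <= d x x' + d x' y' + d y y'.
Proof.
apply: le_trans (metric_triangle x x' y) _; rewrite -addrA lerD2l.
by rewrite (metric_sym y y') metric_triangle.
Qed.

Lemma mdist_lim_eq (u v : nat -> X) (a b : X) (r : R) :
  u n @[n --> \oo] --> a -> v n @[n --> \oo] --> b ->
  (\forall n \near \oo, d (u n) (v n) = r) -> d a b = r.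
Proof.
move=> ua vb uvr.
have close e : 0 < e -> exists n,
    (d a (u n) < e / 2 /\ d b (v n) < e / 2) /\ d (u n) (v n) = r.
  move=> e0; have e2 : 0 < e / 2 by rewrite divr_gt0.
  apply: (@filter_ex _ \oo); apply: filterI => //.
  by apply: filterI; [exact: (metricType_numDomainType.cvgr_dist_lt ua)
    |exact: (metricType_numDomainType.cvgr_dist_lt vb)].
apply/eqP; rewrite eq_le; apply/andP; split; apply/ler_addgt0Pl => e e0;
  have [n [[un vn] <-]] := close e e0.
- by have := le_mdistD a b (u n) (v n); lra.
- have := le_mdistD (u n) (v n) a b.
  by rewrite (metric_sym (u n) a) (metric_sym (v n) b); lra.
Qed.

End limits_of_distances.

(** * Asymptotic centers of bounded orbits *)

Section CAT_fixed_points.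
Context {R : realType} {X : completeMetricType R}.
Notation d := (@mdist R X).
Context (hX : CAT_minus1 d) (K : set X).
Context (Kcl : closed K) (Kcv : geodesically_convex d K).

Lemma convex_segment (x y : X) : K x -> K y -> exists c : R -> X,
  [/\ isometric_on d `[0, d x y] c, c 0 = x, c (d x y) = y &
    forall s : R, 0 <= s <= d x y -> K (c s)].
Proof.
move=> Kx Ky; have [S hS] := hX.1 x y.
have SK := Kcv Kx Ky hS; case: hS => c [ci c0 cl SE].
exists c; split => // s sl; apply: SK; rewrite SE.
by exists s => //=; rewrite in_itv.
Qed.

Section asymptotic_center.
Context (u : nat -> X).

(** The sublevel sets of the limsup of cosh d(x, u n), up to the boundary value;
    unlike the limsup they make sense without a bound on [u]. *)
Definition eventual_ball (r : R) : set X :=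
  [set x | K x /\ \forall n \near \oo, cosh (d x (u n)) <= r].

Lemma eventual_ball_le (r s : R) : r <= s -> eventual_ball r `<=` eventual_ball s.
Proof.
move=> rs x [Kx xr]; split => //; apply: filterS xr => n /le_trans; exact.
Qed.

(** Uniform convexity: passing to a midpoint gains a factor that depends only on
    the distance of the two points. *)
Lemma eventual_ball_midpoint r y z : eventual_ball r y -> eventual_ball r z ->
  eventual_ball (r / cosh (d y z / 2)) !=set0.
Proof.
move=> [Ky yr] [Kz zr]; have := mdist_ge0 y z.
rewrite le_eqVlt => /predU1P[l0|l0].
  by exists y; rewrite -l0 mul0r cosh0 divr1.
have [c [ci c0 cl cK]] := convex_segment Ky Kz.
set l := d y z in l0 ci cl cK *.
have l2 : 0 < sinh (l / 2) by rewrite sinh_gt0// divr_gt0.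
have hl : 0 <= l / 2 <= l by apply/andP; split; lra.
exists (c (l / 2)); split; first exact: cK.
near=> n.
have yn : cosh (d y (u n)) <= r by near: n.
have zn : cosh (d z (u n)) <= r by near: n.
rewrite ler_pdivlMr ?cosh_gt0// -(ler_pM2l l2).
have := CAT_cosh_le (u n) hX ci c0 cl hl.
rewrite !(metric_sym (u n)) -/l (_ : l - l / 2 = l / 2); last by field.
have -> : sinh l = 2 * sinh (l / 2) * cosh (l / 2).
  have {1}-> : l = l / 2 - - (l / 2) by field.
  by rewrite sinhB coshN sinhN; ring.
nra.
Unshelve. all: by end_near. Qed.

Context (bounded : exists r, eventual_ball r !=set0).

(** The cosh of the asymptotic radius of [u] in [K]. *)
Definition radius : R := inf [set r | eventual_ball r !=set0].

Lemma eventual_ball_ge1 : lbound [set r | eventual_ball r !=set0] 1.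
Proof.
move=> r [x [_ xr]]; have [n] := @filter_ex _ \oo _ _ xr.
by apply: le_trans; exact: cosh_ge1.
Qed.

Lemma radius_ge1 : 1 <= radius.
Proof. exact: lb_le_inf eventual_ball_ge1. Qed.

Lemma radius_le r : eventual_ball r !=set0 -> radius <= r.
Proof. by move=> ?; apply: ge_inf => //; exists 1; exact: eventual_ball_ge1. Qed.

Lemma eventual_ball_radius e : 0 < e -> eventual_ball (radius + e) !=set0.
Proof.
move=> e0; have hi : has_inf [set r | eventual_ball r !=set0].
  by split => //; exists 1; exact: eventual_ball_ge1.
have [r [x xr] /ltW re] := inf_adherent e0 hi.
by exists x; exact: eventual_ball_le xr.
Qed.

(** The midpoint of [y] and [z] cannot beat the radius, so the gain of
    [eventual_ball_midpoint] is at most [e]. *)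
Lemma eventual_ball_small e y z : eventual_ball (radius + e) y ->
  eventual_ball (radius + e) z -> d y z ^+ 2 <= 32 * e.
Proof.
move=> ye ze; have := radius_le (eventual_ball_midpoint ye ze).
rewrite ler_pdivlMr ?cosh_gt0//.
have := cosh_ge_sqr (d y z / 2); have := radius_ge1.
have := sqr_ge0 (d y z); rewrite expr_div_n; nra.
Qed.

(** A minimizing sequence [v] is Cauchy, and d(v n, f (v n)) tends to 0 since
    [f (v n)] is as good a minimizer as [v n]. *)
Lemma asymptotic_center_fixed (f : X -> X) :
  (forall x, K x -> K (f x)) -> nonexpansive_on d K f ->
  (forall r x, eventual_ball r x -> eventual_ball r (f x)) ->
  exists2 x, K x & f x = x.
Proof.
move=> fK fne fE.
have e0 k : 0 < k.+1%:R^-1 :> R by rewrite invr_gt0 ltr0n.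
have [v vE] := choice (fun k => eventual_ball_radius (e0 k)).
have [|x vx] := @complete_sqr_cvg R X v 32 0.
  move=> k j /andP[_ kj]; apply: eventual_ball_small (vE k) _.
  apply: eventual_ball_le (vE j).
  by rewrite lerD2l lef_pV2 ?posrE ?ltr0n// ler_nat ltnS.
have Kx : K x.
  by apply: closed_cvg vx => //; apply: nearW => k; case: (vE k).
exists x => //; apply: esym; apply: mdist_positivity; apply/eqP.
rewrite eq_le mdist_ge0 andbT; apply/ler_addgt0Pl => e ep; rewrite addr0.
have e3 : 0 < e / 3 by rewrite divr_gt0.
have [n [vn hn]] : exists n, d x (v n) < e / 3 /\ 32 * n.+1%:R^-1 < (e / 3) ^+ 2.
  apply: (@filter_ex _ \oo); apply: filterI.
    exact: (metricType_numDomainType.cvgr_dist_lt vx).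
  pose m := Num.bound (32 / (e / 3) ^+ 2).
  have hm : 32 / (e / 3) ^+ 2 < m%:R.
    by apply: archi_boundP; rewrite divr_ge0// ltW// exprn_gt0.
  exists m => // n /= mn; rewrite ltr_pdivrMr ?ltr0n// mulrC -ltr_pdivrMr ?exprn_gt0//.
  by apply: lt_le_trans hm _; rewrite ler_nat ltnW.
have vfv : d (v n) (f (v n)) < e / 3.
  rewrite -(@ltr_pXn2r _ 2)// ?nnegrE ?mdist_ge0// ?ltW//.
  by apply: le_lt_trans hn; apply: eventual_ball_small (vE n) (fE _ _ (vE n)).
have := fne x (v n) Kx (vE n).1.
by have := le_mdistD x (f x) (v n) (f (v n)); lra.
Qed.

End asymptotic_center.

Lemma bounded_orbit_fixed (f : X -> X) (o : X) (M : R) :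
  (forall x, K x -> K (f x)) -> nonexpansive_on d K f -> K o ->
  (forall n, d o (iter n f o) <= M) -> exists2 x, K x & f x = x.
Proof.
move=> fK fne Ko oM.
have Ku n : K (iter n f o) by elim: n => //= n /fK.
apply: (@asymptotic_center_fixed (fun n => iter n f o)) => //.
  exists (cosh M), o; split => //.
  by apply: nearW => n; apply: le_cosh => //; exact: mdist_ge0.
move=> r x [Kx [N _ xr]]; split; first exact: fK.
exists N.+1 => // -[//|n] /= nN.
by apply: le_trans (xr n nN); apply: le_cosh; [exact: mdist_ge0|exact: fne].
Qed.

(** * Unbounded orbits produce rays *)

(** The hypothesis d(y,z) <= d(o,z) makes the Gromov product of [y] and [z] at
    [o] at least d(o,y)/2, so both segments stay close to each other as long as
    [t] is small compared with d(o,y). The inequality is applied to [z] and the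
    segment [a], then to [a t] and the segment [b]; it yields
    cosh d(a t, b t) <= 1 + sinh t ^ 2 / sinh d(o,y). *)
Lemma thin_segments (o y z : X) (a b : R -> X) (t : R) :
  isometric_on d `[0, d o y] a -> a 0 = o -> a (d o y) = y ->
  isometric_on d `[0, d o z] b -> b 0 = o -> b (d o z) = z ->
  0 <= t <= d o y -> 0 < d o y -> t <= d o z -> 0 < d o z -> d y z <= d o z ->
  d (a t) (b t) ^+ 2 <= 16 * sinh t ^+ 2 / d o y.
Proof.
move=> ai a0 al bi b0 bl /andP[t0 ty] y0 tz z0 yz.
have hy : 0 <= t <= d o y by rewrite t0.
have hz : 0 <= t <= d o z by rewrite t0.
have h1 := CAT_cosh_le z hX ai a0 al hy.
have h2 := CAT_cosh_le (a t) hX bi b0 bl hz.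
have oa : d (a t) o = t.
  have z' : `[0, d o y]%classic 0 by rewrite /= in_itv/= lexx ltW.
  have t' : `[0, d o y]%classic t by rewrite /= in_itv/= t0.
  by rewrite -[X in d _ X]a0 ai// subr0 ger0_norm.
rewrite ler_pdivlMr//; move: h1 h2.
rewrite oa (metric_sym z (a t)) (metric_sym z o) (metric_sym z y) !sinhB.
have dyz := le_cosh (mdist_ge0 _ _) yz.
have hd := cosh_ge_sqr (d (a t) (b t)).
have Sy2 := sinh_ge_half (ltW y0).
have SC := cosh_le_sinhD1 (ltW z0).
have := cosh_ge1 (d o z - d o y); rewrite coshB.
have Sy := sinh_gt0 y0; have Sz := sinh_gt0 z0.
have q0 := sinh_ge0 t0; have p2 := cosh2_sinh2 t.
move: dyz hd Sy2 SC Sy Sz q0 p2.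
move: (cosh (d y z)) (cosh (d (a t) (b t))) (cosh (d (a t) z)) => Cyz B A.
move: (sinh (d o y)) (cosh (d o y)) (sinh (d o z)) (cosh (d o z)) => Sy Cy Sz Cz.
move: (sinh t) (cosh t) (sqr_ge0 (d (a t) (b t))) => q p.
move: (d (a t) (b t) ^+ 2) => D D0 dyz hd Sy2 SC Sy0 Sz0 q0 p2 CC h1 h2.
have h1' : Sy * A <= (Sy * p - Cy * q + q) * Cz.
  by apply: le_trans h1 _; have := ler_wpM2l q0 dyz; lra.
have h3 : Sz * (Sy * B) <= Sz * (Sy + q ^+ 2).
  have e1 := ler_wpM2l (ltW Sy0) h2; have e2 := ler_wpM2l q0 h1'.
  (* the difference of the two sides is at least this product, where
     cosh L - sinh L <= 1 <= cosh (L - L') makes the second factor nonnegative *)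
  have e3 : 0 <= q ^+ 2 * (Sz + (Cz * Cy - Sz * Sy) - Cz).
    by apply: mulr_ge0; [exact: sqr_ge0|lra].
  have e4 : Sz * Sy * p ^+ 2 = Sz * Sy * (1 + q ^+ 2) by rewrite p2.
  lra.
move: h3; rewrite ler_pM2l// => h3.
nra.
Qed.

(** The points [y k] converge to a point at infinity, which the limit of the
    segments from [o] to [y k] reaches. *)
Lemma escaping_ray (o : X) (y : nat -> X) : K o -> (forall k, K (y k)) ->
  (forall k, k.+1%:R < d o (y k)) ->
  (forall k j, (k <= j)%N -> d (y k) (y j) <= d o (y j)) ->
  exists c : R -> X, isometric_on d `[0, +oo[ c /\ c @` `[0, +oo[ `<=` K.
Proof.
move=> Ko Ky yk yj.
have [a aP] := choice (fun k => convex_segment Ko (Ky k)).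
have y0 k : 0 < d o (y k) by apply: le_lt_trans (yk k).
have near_le t : \forall k \near \oo, t <= d o (y k).
  exists (Num.bound `|t|) => // k /= tk; apply: ltW; apply: lt_trans (yk k).
  apply: le_lt_trans (ler_norm t) _; apply: lt_le_trans (archi_boundP _) _ => //.
  by rewrite ler_nat ltnW.
have conv (t : R) : exists x : X, 0 <= t -> a k t @[k --> \oo] --> x.
  have [t0|_] := boolP (0 <= t); last by exists o.
  have [N _ hN] := near_le t.
  have [|x ax] := @complete_sqr_cvg R X (fun k => a k t) (16 * sinh t ^+ 2) N.
    move=> k j /andP[Nk kj].
    have [aki ak0 akl _] := aP k; have [aji aj0 ajl _] := aP j.
    apply: le_trans (thin_segments aki ak0 akl aji aj0 ajl _ _ _ _ _) _ => //.
    + by rewrite t0 hN.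
    + by apply: hN; exact: leq_trans kj.
    + exact: yj.
    + apply: ler_wpM2l; first by rewrite mulr_ge0// sqr_ge0.
      by rewrite lef_pV2 ?posrE ?ltr0n// ltW.
  by exists x.
have [c cP] := choice conv.
exists c; split.
- move=> s t; rewrite /= !in_itv/= !andbT => s0 t0.
  apply: mdist_lim_eq (cP s s0) (cP t t0) _.
  near=> k.
  have [ai _ _ _] := aP k.
  by apply: ai; rewrite /= in_itv/= ?s0 ?t0 /=; near: k; exact: near_le.
- move=> _ [t tI <-]; have t0 : 0 <= t by move: tI; rewrite /= in_itv/= andbT.
  apply: closed_cvg (cP t t0) => //.
  near=> k.
  have [_ _ _ aK] := aP k.
  by apply: aK; rewrite t0 /=; near: k; exact: near_le.
Unshelve. all: by end_near. Qed.

(** Subsequences of the orbit along first exit times satisfy the condition of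
    [escaping_ray] because [f] maps the pair of points of indices 0 and m to
    the pair of points of indices n and n + m without increasing distances. *)
Lemma unbounded_orbit_ray (f : X -> X) (o : X) :
  (forall x, K x -> K (f x)) -> nonexpansive_on d K f -> K o ->
  (forall M : R, exists n, M < d o (iter n f o)) ->
  exists c : R -> X, isometric_on d `[0, +oo[ c /\ c @` `[0, +oo[ `<=` K.
Proof.
move=> fK fne Ko unb.
have Ku n : K (iter n f o) by elim: n => //= n /fK.
have shift n m : d (iter n f o) (iter (n + m) f o) <= d o (iter m f o).
  by elim: n => //= n; apply: le_trans; exact: fne.
have first_exit (k : nat) : exists n, k.+1%:R < d o (iter n f o) /\
    forall m, (m < n)%N -> d o (iter m f o) <= k.+1%:R.
  have [n kn nmin] := ex_minnP (unb k.+1%:R); exists n; split => // m mn.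
  by rewrite leNgt; apply: contraL mn => /nmin; rewrite -leqNgt.
have [n nP] := choice first_exit.
apply: (@escaping_ray o (fun k => iter (n k) f o)) => //.
  by move=> k; case: (nP k).
move=> k j kj.
have [jn jmin] := nP j; have [kn kmin] := nP k.
have nkj : (n k <= n j)%N.
  rewrite leqNgt; apply/negP => /kmin; apply/negP; rewrite -ltNge.
  by apply: le_lt_trans jn; rewrite ler_nat ltnS.
have := shift (n k) (n j - n k)%N; rewrite subnKC// => /le_trans; apply.
have [->|nk0] := posnP (n k); first by rewrite subn0.
apply/ltW/(le_lt_trans _ jn)/jmin.
by rewrite ltn_subrL nk0 (leq_trans nk0 nkj).
Qed.

Lemma bounded_fixed_point (o : X) (f : X -> X) : geodesically_bounded d K ->
  K o -> (forall x, K x -> K (f x)) -> nonexpansive_on d K f ->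
  exists2 x, K x & f x = x.
Proof.
move=> gb Ko fK fne; apply: contrapT => nofix.
apply: gb; apply: (unbounded_orbit_ray fK fne Ko) => M.
apply: contrapT => nM; apply: nofix; apply: (@bounded_orbit_fixed f o M) => //.
by move=> n; rewrite leNgt; apply/negP => hn; apply: nM; exists n.
Qed.

End CAT_fixed_points.

(** * Rays obstruct fixed points *)

Section ray_translation.
Context {R : realType} {X : metricType R}.
Notation d := (@mdist R X).
Context (c : R -> X) (cray : isometric_on d `[0, +oo[ c).

(** By the triangle inequality d(x, c t) - t is nonincreasing in [t], so that
    its infimum is its limit at infinity, the usual Busemann function. *)
Definition busemann (x : X) : R := inf [set d x (c t) - t | t in `[0, +oo[].

Lemma busemann_has_lbound x : has_lbound [set d x (c t) - t | t in `[0, +oo[].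
Proof.
exists (- d x (c 0)) => _ [t t0 <-].
have e : d (c t) (c 0) = t.
  rewrite cray//=; last by rewrite in_itv/= lexx.
  by rewrite subr0 ger0_norm//; move: t0; rewrite /= in_itv/= andbT.
by have := metric_triangle (c t) x (c 0); rewrite e (metric_sym (c t)); lra.
Qed.

Lemma busemann_lipschitz x y : busemann x - busemann y <= d x y.
Proof.
rewrite lerBlDr -lerBlDl; apply: lb_le_inf.
  by exists (d y (c 0) - 0), 0 => //=; rewrite in_itv/= lexx.
move=> _ [t t0 <-]; rewrite lerBlDl.
apply: (@le_trans _ _ (d x (c t) - t)).
  by apply: ge_inf; [exact: busemann_has_lbound|exists t].
by have := metric_triangle x y (c t); lra.
Qed.

Lemma busemann_ray s : 0 <= s -> busemann (c s) = - s.
Proof.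
move=> s0; have sI : `[0, +oo[%classic s by rewrite /= in_itv/= s0.
apply/eqP; rewrite eq_le; apply/andP; split.
  apply: ge_inf; first exact: busemann_has_lbound.
  by exists s => //; rewrite cray// subrr normr0 sub0r.
apply: lb_le_inf; first by exists (d (c s) (c s) - s), s.
by move=> _ [t tI <-]; rewrite cray//; have := ler_norm (t - s); rewrite distrC; lra.
Qed.

(** On the ray itself this is the shift by one unit, which moves every point;
    the truncation at 0 keeps the parameter in the domain of [c]. *)
Definition ray_translation (x : X) : X := c (Num.max 0 (- busemann x) + 1).

Lemma ray_translation_nonexpansive x y :
  d (ray_translation x) (ray_translation y) <= d x y.
Proof.
have I z : `[0, +oo[%classic (Num.max 0 (- busemann z) + 1).
  by rewrite /= in_itv/= andbT addr_ge0// le_max lexx.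
rewrite cray//.
have := busemann_lipschitz x y; have := busemann_lipschitz y x.
rewrite (metric_sym y x) ler_norml; have := mdist_ge0 x y.
by case: (leP 0 (- busemann x)); case: (leP 0 (- busemann y));
  move=> *; apply/andP; split; lra.
Qed.

Lemma ray_translation_no_fixpoint x : ray_translation x <> x.
Proof.
rewrite /ray_translation; set s := Num.max _ _ + 1 => cs.
have m0 : 0 <= Num.max 0 (- busemann x) by rewrite le_max lexx.
have s0 : 0 <= s by rewrite addr_ge0.
have := busemann_ray s0; rewrite cs => e.
by move: (erefl s); rewrite {2}/s e opprK max_r//; lra.
Qed.

End ray_translation.

(** * The fixed point property *)

Theorem theorem4p1 (R : realType) (X : completeMetricType R)
    (hX : CAT_minus1 (@mdist R X))
    (K : set X) (K_nonempty : K !=set0) (K_closed : closed K)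
    (K_convex : geodesically_convex (@mdist R X) K) :
  nonexpansive_fixed_point_property (@mdist R X) K <->
  geodesically_bounded (@mdist R X) K.
Proof.
split=> [fpp [c [ci cK]]|gb f fne].
- have TK : set_fun K K (ray_translation c).
    move=> x _; apply: cK; exists (Num.max 0 (- busemann c x) + 1) => //.
    by rewrite /= in_itv/= andbT addr_ge0// le_max lexx.
  have [|x _] := fpp (mkfun_fun TK).
    by move=> x y _ _; exact: ray_translation_nonexpansive.
  exact: ray_translation_no_fixpoint.
- have [x0 Kx0] := K_nonempty.
  by apply: (bounded_fixed_point hX K_closed K_convex gb Kx0) => // x; exact: funS.
Qed.
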